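(* Let $x,y$ be roots of unity and $p,q\ge1$ integers with $(p,y)\neq(1,1)$ and $(q,xy)\neq(1,1)$. Then \begin{align*} &y^{-1}\tilde S_{p;q}\big(y;(xy)^{-1}\big)-(-1)^{p+q}\tilde S_{p;q}\big(y^{-1};xy\big)\\ &=y^{-1}\mathrm{Li}_q\big((xy)^{-1}\big)\mathrm{ti}_p(y)+(-1)^qy^{-1}\mathrm{Li}_q(xy)\mathrm{ti}_p(y)+(-1)^q\binom{p+q-1}{p-1}y^{-1}\mathrm{ti}_{p+q}(y)\\ &\quad+(-1)^q(xy)^{-1}\sum_{m=0}^{p-1}\binom{p+q-m-2}{q-1}\mathrm{ti}_{p+q-m-1}(xy)\Big((-1)^m\mathrm{ti}_{m+1}(x)-x\,\mathrm{ti}_{m+1}(x^{-1})\Big)\\ &\quad+(-1)^qy^{-1}\sum_{m=0}^{q-1}\binom{p+q-m-2}{p-1}\mathrm{ti}_{p+q-m-1}(y)\Big((-1)^m\mathrm{Li}_{m+1}(x^{-1})-\mathrm{Li}_{m+1}(x)\Big). \end{align*}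
   Context: For $p\in\mathbb{N}$, $n\ge0$, root of unity $z$: $t_n(p;z)=\sum_{k=1}^n z^k/(k-1/2)^p$ (empty sum $0$). For $|z|\le1$, $(m,z)\ne(1,1)$: $\mathrm{Li}_m(z)=\sum_{n\ge1}z^n/n^m$, $\mathrm{ti}_m(z)=\sum_{n\ge1}z^n/(n-1/2)^m$. For positive integers $p,q$ and roots of unity $z_1,z$ with $(q,z)\ne(1,1)$: $\tilde S_{p;q}(z_1;z)=\sum_{n\ge1}\frac{t_n(p;z_1)}{n^q}z^n$. *)

(* Defs.v *)
From HB Require Import structures.
From mathcomp Require Export all_boot all_order all_algebra.
From mathcomp Require Export complex.
From mathcomp Require Export boolp classical_sets reals topology normedtype.
From mathcomp Require Export sequences.

Set Implicit Arguments.
Unset Strict Implicit.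
Unset Printing Implicit Defensive.

Import GRing.Theory Num.Theory.
Import numFieldNormedType.Exports.

Local Open Scope ring_scope.
Local Open Scope complex_scope.

(* [0 < n] is needed: every element is a root of ['X^0 - 1 = 0]. *)
Definition root_of_unity (F : fieldType) (z : F) : Prop :=
  exists2 n : nat, (0 < n)%N & n.-unity_root z.

(* The limit of the partial sums [u 1 + ... + u N] for the modulus topology of
   the complex numbers, carried by the regular module [R[i]^o].  It is total:
   when the partial sums diverge, its value is unspecified. *)
Definition csum (R : realType) (u : nat -> R[i]) : R[i] :=
  limn (fun N => \sum_(1 <= n < N.+1) u n : R[i]^o).

Section EulerTSums.
Variable R : realType.
Implicit Types (m n p q : nat) (z : R[i]).

Definition tpart n p z : R[i] :=
  \sum_(1 <= k < n.+1) z ^+ k / (k%:R - 2^-1) ^+ p.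

Definition Li m z : R[i] := csum (fun n => z ^+ n / n%:R ^+ m).

Definition ti m z : R[i] := csum (fun n => z ^+ n / (n%:R - 2^-1) ^+ m).

Definition Stilde p q (z1 z : R[i]) : R[i] :=
  csum (fun n => tpart n p z1 / n%:R ^+ q * z ^+ n).

End EulerTSums.

(* Main.v *)
Require Import Defs.
From mathcomp Require Import zify ring lra.

(** Write [w = x * y] and consider the finite sums of
    [w ^ (- n) / n ^ q * y ^ k / (k - 1/2) ^ p] over [- N <= n < k <= N], [n <> 0].
    Summing over [k] first yields the partial sums of the two [Stilde] and of the
    products [Li * ti].  Substituting [k = n + j] and expanding
    [1 / (n ^ q * (n + (j - 1/2)) ^ p)] into partial fractions in [n] yields, for
    each simple term, a sum [sum_n g n * P (N - n)] or [sum_k h k * P (N + k)],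
    where [P] is a partial sum of some [ti].  By summation by parts
    [P m = ti + O(1/m)], and [g n], [h n] are [O(1/|n|)], so that replacing [P] by
    its limit costs [O(log N / N)].  What is left is the product of [ti] with a
    symmetric bilateral sum, which converges even when [x = 1] and the exponent
    is [1]. *)

Set Implicit Arguments.
Unset Strict Implicit.
Unset Printing Implicit Defensive.

Import Order.TTheory GRing.Theory Num.Theory.
Import numFieldNormedType.Exports.

Local Open Scope ring_scope.
Local Open Scope complex_scope.

(** * Partial fractions in a commutative ring, without division *)

Section PartialFractions.
Variable A : comPzRingType.
Implicit Types a b c e : A.

(** The hypothesis is [1/(n (n + a)) = (1/a) (1/n - 1/(n + a))] with [b = 1/n], [c = 1/(n + a)],
    [e = 1/a]. Each further factor [c] meets the single remaining [b] and is expanded again. *)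
Lemma partial_fraction_linear b c e P : b * c = e * (b - c) ->
  b * c ^+ P.+1 =
    e ^+ P.+1 * b - \sum_(0 <= m < P.+1) e ^+ (P.+1 - m) * c ^+ m.+1.
Proof.
move=> h; elim: P => [|P IH]; first by rewrite big_nat1 !expr1 h; ring.
have -> : b * c ^+ P.+2 = e ^+ P.+1 * (b * c) -
    (\sum_(0 <= m < P.+1) e ^+ (P.+1 - m) * c ^+ m.+1) * c.
  by rewrite [c ^+ P.+2]exprSr mulrA IH; ring.
rewrite h [in RHS]big_nat_recl// subn0 expr1 mulr_suml.
under [X in _ = _ - (_ + X)]eq_big_nat => m _ do
  rewrite subSS [c ^+ m.+2]exprSr mulrA.
by rewrite [e ^+ P.+2]exprSr; ring.
Qed.

(** Replacing one factor [b * c] by [e * (b - c)] lowers one of the two exponents, so the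
    coefficients obey Pascal's rule. The induction is on [P + Q], with the linear case on the
    border. *)
Lemma partial_fraction b c e P Q : b * c = e * (b - c) ->
  b ^+ Q.+1 * c ^+ P.+1 =
    \sum_(0 <= m < Q.+1)
      (-1) ^+ (Q - m) * 'C(P + Q - m, P)%:R * e ^+ (P + Q - m).+1 * b ^+ m.+1 +
    \sum_(0 <= m < P.+1)
      (-1) ^+ Q.+1 * 'C(P + Q - m, Q)%:R * e ^+ (P + Q - m).+1 * c ^+ m.+1.
Proof.
move=> h; have [n le_n] := ubnP (P + Q); elim: n P Q le_n => // n IH [|P] [|Q] le_n.
- rewrite !big_nat1 !expr1 h bin0 /=; ring.
(* Swapping [b] and [c] turns [e] into [- e] and reduces [P = 0] to the linear case. *)
- have h' : c * b = - e * (c - b) by rewrite mulrC h; ring.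
  rewrite expr1 mulrC (partial_fraction_linear _ h') addrC; congr (_ + _).
    rewrite -sumrN; apply: eq_big_nat => m lt_m.
    rewrite add0n bin0 (_ : (Q.+2 - m = (Q.+1 - m).+1)%N); last by lia.
    by rewrite [(- e) ^+ _]exprNn [(-1) ^+ _.+1]exprS; ring.
  by rewrite big_nat1 add0n subn0 binn expr1 [(- e) ^+ _]exprNn; ring.
- rewrite expr1 (partial_fraction_linear _ h); congr (_ + _).
    by rewrite big_nat1 addn0 !subn0 binn; ring.
  rewrite -sumrN; apply: eq_big_nat => m lt_m.
  rewrite addn0 bin0 (_ : (P.+2 - m = (P.+1 - m).+1)%N); last by lia.
  by ring.
have -> : b ^+ Q.+2 * c ^+ P.+2 = e * (b ^+ Q.+2 * c ^+ P.+1 - b ^+ Q.+1 * c ^+ P.+2).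
  transitivity (b * c * (b ^+ Q.+1 * c ^+ P.+1)); first by rewrite !exprS; ring.
  by rewrite h !exprS; ring.
rewrite (IH P Q.+1) ?(IH P.+1 Q); [|lia..].
have pascal k l : 'C(k.+1 + l.+1, k.+1)%:R =
    'C(k.+1 + l, k.+1)%:R + 'C(k + l.+1, k)%:R :> A.
  by rewrite -natrD addSn binS addSnnS.
(* The top power of [b] occurs only in the first smaller expansion, that of [c] only in the second.
   Both are split off; Pascal's rule handles the rest. *)
symmetry; rewrite [X in X + _ = _]big_nat_recr// [X in _ = _ * (X + _ - _)]big_nat_recr//=.
rewrite [X in _ + X = _]big_nat_recr// [X in _ = _ * (_ - (_ + X))]big_nat_recr//=.
have combine s1 t1 s2 t2 s3 t3 s4 t4 s5 s6 : s1 = e * (s2 - s3) ->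
    t1 = e * t2 -> s4 = e * (s5 - s6) -> t3 = - (e * t4) ->
    s1 + t1 + (s4 + t3) = e * (s2 + t2 + s5 - (s3 + (s6 + t4))) :> A.
  by move=> -> -> -> ->; ring.
apply: combine.
- rewrite -sumrB mulr_sumr; apply: eq_big_nat => m /andP[_ lt_m].
  rewrite -!addnBA ?(ltnW lt_m)// !subSn// pascal addSnnS !addnS ?addSn !exprS; ring.
- rewrite subnn !addnK !binn [e ^+ P.+2]exprS; ring.
- rewrite -sumrB mulr_sumr; apply: eq_big_nat => m /andP[_ lt_m].
  have -> : (P.+1 + Q.+1 - m = Q.+1 + (P - m).+1)%N by lia.
  have -> : (P + Q.+1 - m = Q.+1 + (P - m))%N by lia.
  have -> : (P.+1 + Q - m = Q + (P - m).+1)%N by lia.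
  rewrite pascal addSnnS [(-1) ^+ Q.+2]exprS [e ^+ (Q.+1 + _).+1]exprS.
  by rewrite addSnnS !addnS; ring.
- by rewrite !addKn !binn [(-1) ^+ Q.+2]exprS [e ^+ Q.+2]exprS; ring.
Qed.
End PartialFractions.

(** At [n = 0] all terms of the second partial fraction sum carry the same power; their coefficients
    add up to the binomial in front of [ti (p + q) y]. *)
Lemma hockey_stick P Q :
  (\sum_(0 <= m < P.+1) 'C(P + Q - m, Q) = 'C(P + Q + 1, P))%N.
Proof.
elim: P => [|P IH]; first by rewrite big_nat1 add0n subn0 binn bin0.
rewrite big_nat_recl// subn0 (eq_big_nat _ _ (F2 := fun m => 'C(P + Q - m, Q))); last first.
  by move=> m _; rewrite addSn subSS.
rewrite IH !addn1 binS; congr (_ + _)%N.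
by rewrite -[RHS]bin_sub ?addSn ?subSS ?addKn //; lia.
Qed.

(** * Finite sums over centered intervals and triangles *)

Section BilateralSums.
Variable V : zmodType.
Implicit Types (f : int -> V) (g : nat -> V).

Lemma sum_centered f N :
  \sum_(0 <= u < (2 * N).+1) f (u%:Z - N%:Z) =
  f 0 + \sum_(1 <= n < N.+1) (f n%:Z + f (- n%:Z)).
Proof.
rewrite (big_cat_nat (n := N.+1))//=; last by lia.
rewrite big_nat_recr//= subrr big_split/= [X in X + _]addrC -addrA; congr (_ + _).
rewrite addrC; congr (_ + _).
  rewrite -[X in \sum_(X <= _ < _) _]add1n big_addn (_ : (2 * N).+1 - N = N.+1)%N; last by lia.
  by apply: eq_big_nat => n _; congr f; lia.
rewrite big_nat_rev/= big_add1 /= add0n; apply: eq_big_nat => n lt_n.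
by congr f; lia.
Qed.

(** The pairing is the reflection of the integers about [1/2], which leaves the end [- N]
    unpaired. *)
Lemma sum_centered_half f N :
  \sum_(0 <= u < (2 * N).+1) f (u%:Z - N%:Z) =
  f (- N%:Z) + \sum_(1 <= n < N.+1) (f n%:Z + f (1 - n%:Z)).
Proof.
rewrite big_nat_recl// sub0r; congr (_ + _).
rewrite (big_cat_nat (n := N))//=; last by lia.
rewrite big_split/= addrC; congr (_ + _).
  rewrite -[N in \sum_(N <= _ < _) _]add0n big_addn (_ : 2 * N - N = N)%N; last by lia.
  by rewrite [RHS]big_add1/=; apply: eq_big_nat => n _; congr f; lia.
rewrite big_nat_rev/= big_add1 /= add0n; apply: eq_big_nat => n lt_n.
by congr f; lia.
Qed.

Lemma exchange_triangle (F : nat -> nat -> V) M :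
  \sum_(0 <= u < M) \sum_(u.+1 <= v < M) F u v =
  \sum_(0 <= v < M) \sum_(0 <= u < v) F u v.
Proof.
elim: M => [|M IH]; first by rewrite !big_geq.
rewrite [RHS]big_nat_recr//= -IH -big_split/= big_nat_recr//=.
rewrite [X in _ + X = _]big_geq// addr0.
by apply: eq_big_nat => u lt_u; rewrite big_nat_recr.
Qed.

Lemma sum_shift_sub g u M : \sum_(u.+1 <= v < M) g (v - u)%N = \sum_(1 <= j < M - u) g j.
Proof.
rewrite -[u.+1]add1n big_addn.
by apply: eq_big_nat => j _; rewrite addnK.
Qed.

Lemma sum_rev_sub g v : \sum_(0 <= u < v) g (v - u)%N = \sum_(1 <= j < v.+1) g j.
Proof.
rewrite big_nat_rev/= big_add1/=; apply: eq_big_nat => u lt_u.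
by congr g; lia.
Qed.

End BilateralSums.

(** * Complex limits and majorized series *)

Section ComplexLimits.
Local Open Scope classical_set_scope.
Variable R : realType.
Implicit Types (u v : nat -> R[i]) (l : R[i]).

(** The regular module carries the topology in which [csum] takes its limit. *)
Definition clim u l := (u : nat -> R[i]^o) @ \oo --> (l : R[i]^o).

Lemma clim_csum u l : clim (fun N => \sum_(1 <= n < N.+1) u n) l -> csum u = l.
Proof. by move=> h; exact: (cvg_lim (@norm_hausdorff _ R[i]^o) h). Qed.

Lemma clim_unique u l l' : clim u l -> clim u l' -> l = l'.
Proof.
by move=> h h'; rewrite -(cvg_lim (@norm_hausdorff _ R[i]^o) h) (cvg_lim (@norm_hausdorff _ R[i]^o) h').
Qed.

Lemma eq_clim u v l : u =1 v -> clim u l -> clim v l.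
Proof. by move=> /funext->. Qed.

Lemma clim_cst l : clim (fun=> l) l.
Proof. exact: cvg_cst. Qed.

Lemma climD u v l l' : clim u l -> clim v l' -> clim (fun n => u n + v n) (l + l').
Proof. exact: cvgD. Qed.

Lemma climB u v l l' : clim u l -> clim v l' -> clim (fun n => u n - v n) (l - l').
Proof. exact: cvgB. Qed.

Lemma climM u v l l' : clim u l -> clim v l' -> clim (fun n => u n * v n) (l * l').
Proof. exact: cvgM. Qed.

Lemma clim_sum (F : nat -> nat -> R[i]) (f : nat -> R[i]) m n :
  (forall i, (m <= i < n)%N -> clim (F i) (f i)) ->
  clim (fun N => \sum_(m <= i < n) F i N) (\sum_(m <= i < n) f i).
Proof.
elim: n => [|n IH] h.
  by rewrite big_geq//; apply: (@eq_clim (fun=> 0)); [move=> N; rewrite big_geq|exact: clim_cst].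
have [le_mn|lt_nm] := leqP m n; last first.
  by rewrite big_geq//; apply: (@eq_clim (fun=> 0)); [move=> N; rewrite big_geq|exact: clim_cst].
rewrite big_nat_recr//.
apply: (@eq_clim (fun N => \sum_(m <= i < n) F i N + F n N)).
  by move=> N; rewrite big_nat_recr.
apply: climD; last by apply: h; rewrite le_mn /=.
by apply: IH => i /andP[mi lt_in]; apply: h; rewrite mi ltnW.
Qed.

Lemma climP u l : clim u l <->
  forall e : R, 0 < e -> \forall n \near \oo, `|l - u n| <= e%:C.
Proof.
split=> [/cvgrPdist_le h e e0|h]; first by apply: h; rewrite ltcR.
apply/cvgrPdist_le => e e0; have er : e \is Num.real by apply: gtr0_real.
by rewrite -(RRe_real er); apply: h; rewrite -ltcR (RRe_real er).
Qed.

Lemma clim_bound u l (r : nat -> R) :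
  (forall n, `|l - u n| <= (r n)%:C) -> r @ \oo --> 0 -> clim u l.
Proof.
move=> h /cvgrPdist_le hr; apply/climP => e e0.
near=> n; apply: le_trans (h n) _; rewrite lecR.
have : `|0 - r n| <= e by near: n; exact: hr.
by rewrite sub0r normrN; apply: le_trans; exact: ler_norm.
Unshelve. all: by end_near.
Qed.

Lemma clim_ReIm u (a b : R) :
  (fun n => complex.Re (u n)) @ \oo --> a -> (fun n => complex.Im (u n)) @ \oo --> b ->
  clim u (a +i* b)%C.
Proof.
move=> /cvgrPdist_le ha /cvgrPdist_le hb; apply/climP => e e0.
have e2 : 0 < e / 2 by rewrite divr_gt0.
near=> n.
have hA : `|a - complex.Re (u n)| <= e / 2 by near: n; exact: ha.
have hB : `|b - complex.Im (u n)| <= e / 2 by near: n; exact: hb.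
rewrite normc_def lecR -[leRHS]ger0_norm ?(ltW e0)// -sqrtr_sqr ler_sqrt ?sqr_ge0//.
case: (u n) hA hB => c d /= hA hB.
rewrite -(real_normK (num_real (a - c))) -(real_normK (num_real (b - d))).
have := normr_ge0 (a - c); have := normr_ge0 (b - d); nra.
Unshelve. all: by end_near.
Qed.

(** The increments telescope to [|S n - S m| <= d m - d n] for [m <= n]. Hence the partial sums
    converge, and letting [n] grow bounds the distance from [S m] to the limit by [d m]. *)
Lemma telescope_majorant u (d : nat -> R) :
  (forall n, `|u n.+1| <= (d n - d n.+1)%:C) -> d @ \oo --> 0 ->
  exists l, forall n, `|l - \sum_(1 <= j < n.+1) u j| <= (d n)%:C.
Proof.
move=> hu hd.
pose S n := \sum_(1 <= j < n.+1) u j.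
have S_le m n : (m <= n)%N -> `|S n - S m| <= (d m - d n)%:C.
  elim: n => [|n IH]; first by rewrite leqn0 => /eqP->; rewrite !subrr normr0.
  rewrite leq_eqVlt => /orP[/eqP->|]; first by rewrite !subrr normr0.
  rewrite ltnS => /IH h; rewrite /S big_nat_recr//= -/(S n).
  rewrite addrAC; apply: le_trans (ler_normD _ _) _.
  apply: le_trans (lerD h (hu n)) _.
  by rewrite -rmorphD lecR addrA subrK.
(* [d] is nonincreasing, so a negative value would keep it away from its limit [0]. *)
have d_ge0 n : 0 <= d n.
  rewrite leNgt; apply/negP => dn0.
  have /cvgrPdist_lt /(_ (- d n)) := hd.
  rewrite oppr_gt0 => /(_ dn0) [m _ /(_ (maxn m n)) /=]; rewrite leq_maxl => /(_ isT).
  have := S_le n (maxn m n) (leq_maxr _ _).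
  move=> /(le_trans (normr_ge0 _)); rewrite ler0c.
  set k := d (maxn _ _); rewrite sub0r normrN => h1 h2.
  have := ler_norm (- k); rewrite normrN; lra.
have component (f : R[i] -> R) : {morph f : x y / x - y} -> (forall z, `|f z|%:C <= `|z|) ->
    exists a : R, (fun n => f (S n)) @ \oo --> a.
  move=> fB fle.
  have fS m n : (m <= n)%N -> `|f (S n) - f (S m)| <= d m - d n.
    by move=> /S_le h; rewrite -fB -lecR; exact: le_trans (fle _) h.
  (* Monotone convergence suffices: subtracting [d n] makes the real or imaginary part of [S n]
     nondecreasing, as its variation is at most the decrease of [d]. *)
  have hc : cvgn (fun n => f (S n) - d n).
    apply: nondecreasing_is_cvgn => [m n /fS h|].
      have := ler_norm (f (S m) - f (S n)); rewrite distrC; lra.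
    exists (f (S 0%N) + d 0%N) => _ [n _ <-].
    have := ler_norm (f (S n) - f (S 0%N)); have := fS 0%N n isT; have := d_ge0 n; lra.
  exists (limn (fun n => f (S n) - d n) + 0); 
  have -> : (fun n => f (S n)) = (fun n => f (S n) - d n) \+ d.
    by apply/funext => n /=; rewrite subrK.
  exact: cvgD.
have [a ha] := component (@complex.Re R) (raddfB _) (@normc_ge_Re R).
have [b hb] : exists b : R, (fun n => complex.Im (S n)) @ \oo --> b.
  apply: component => [|z]; first exact: raddfB.
  by rewrite normc_def lecR -sqrtr_sqr ler_wsqrtr// lerDr sqr_ge0.
have /climP hl := clim_ReIm ha hb.
exists (a +i* b)%C => n; rewrite -/(S n).
have nr : `|(a +i* b)%C - S n| \is Num.real by exact: normr_real.
rewrite -(RRe_real nr) lecR; apply/ler_addgt0Pr => e e0.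
rewrite -lecR (RRe_real nr) {nr}.
have [m _ /(_ (maxn m n))] := hl e e0; rewrite /= leq_maxl => /(_ isT) hm.
have := S_le n (maxn m n) (leq_maxr _ _); move: hm; set k := maxn m n => hm hn.
rewrite (_ : (a +i* b)%C - S n = ((a +i* b)%C - S k) + (S k - S n)); last by ring.
apply: le_trans (ler_normD _ _) _; apply: le_trans (lerD hm hn) _.
by rewrite -rmorphD lecR; have := d_ge0 k; lra.
Unshelve. all: by end_near.
Qed.

Lemma norm_root_of_unity (z : R[i]) : root_of_unity z -> `|z| = 1.
Proof.
move=> [n n0]; rewrite unity_rootE => /eqP zn.
by apply/eqP; rewrite -(pexpr_eq1 n0)// -normrX zn normr1.
Qed.


End ComplexLimits.

Arguments clim_cst {R} l.

(** * Real estimates for reciprocals *)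

Section RealBounds.
Local Open Scope classical_set_scope.
Variable R : realType.
Implicit Types (t : R) (s N : nat).

Lemma cvg_divn_succ (K : R) : (fun n => K / n.+1%:R) @ \oo --> 0.
Proof. by rewrite -(mulr0 K); apply: cvgMl_tmp; exact: cvg_harmonic. Qed.

(** [n.+1 - t] is at least half of [n.+1]. The shift [t] treats [Li] ([t = 0]) and [ti] ([t = 1/2])
    together. *)
Lemma shifted_inv_le t n : 0 <= t <= 2^-1 -> 0 <= (n.+1%:R - t)^-1 <= 2 / n.+1%:R.
Proof.
move=> /andP[t0 t1]; have n1 : 1 <= n.+1%:R :> R by rewrite ler1n.
have pos : 0 < n.+1%:R - t by lra.
rewrite invr_ge0 (ltW pos) /= -[2]invrK -invfM lef_pV2 ?posrE//; lra.
Qed.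

Lemma expr_inv_le (a : R) s n m : (m <= s)%N -> 0 <= a <= 2 / n.+1%:R ->
  a ^+ s <= 2 ^+ s / n.+1%:R ^+ m.
Proof.
move=> ms /andP[a0 a1].
have n0 : 0 < n.+1%:R :> R by rewrite ltr0n.
apply: le_trans (_ : (2 / n.+1%:R) ^+ s <= _).
  by rewrite lerXn2r ?nnegrE// divr_ge0.
rewrite expr_div_n ler_wpM2l ?exprn_ge0// lef_pV2 ?posrE ?exprn_gt0//.
by rewrite ler_weXn2l// ler1n.
Qed.

(** This rests on [1/(a b) = (1/a + 1/b) / (a + b)]. *)
Lemma inv_mul_le (a b c : R) : 0 < a -> 0 < b -> 0 < c -> c <= a + b ->
  a^-1 / b <= c^-1 * (a^-1 + b^-1).
Proof.
move=> a0 b0 c0 cab; have ab0 : 0 < a + b by rewrite addr_gt0.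
have -> : a^-1 / b = (a + b)^-1 * (a^-1 + b^-1) by field; rewrite !gt_eqF.
by rewrite ler_wpM2r ?lef_pV2// addr_ge0 ?invr_ge0// ltW.
Qed.

Lemma cvg_convolution_harmonic :
  (fun N => \sum_(0 <= v < (2 * N).+1)
     (`|(v%:Z - N%:Z)%:~R| + 1)^-1 / v.+1%:R) @ \oo --> (0 : R).
Proof.
pose H : R^nat := arithmetic_mean harmonic.
have H0 : (fun N => 6 * H (2 * N)%N) @ \oo --> (0 : R).
  rewrite -(mulr0 6); apply: cvgMl_tmp.
  have H0 := cesaro (@cvg_harmonic R).
  apply: (cvg_comp _ _ _ H0).
  by move=> A [n _ hA]; exists n => // m /= le_nm; apply: hA => /=; lia.
apply: squeeze_cvgr (cvg_cst 0) H0; near=> N => /=; apply/andP; split.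
  by apply: sumr_ge0 => v _; rewrite mulr_ge0 ?invr_ge0// addr_ge0.
pose S : R := \sum_(0 <= v < (2 * N).+1) v.+1%:R^-1.
have S_ge0 : 0 <= S by apply: sumr_ge0 => v _; rewrite invr_ge0.
have HE : H (2 * N)%N = (2 * N).+1%:R^-1 * S by [].
(* The two denominators add up to at least [N + 2], because [|v - N| >= N - v]. *)
have split_le v : (`|(v%:Z - N%:Z)%:~R| + 1)^-1 / v.+1%:R <=
    N.+2%:R^-1 * ((`|(v%:Z - N%:Z)%:~R| + 1)^-1 + v.+1%:R^-1) :> R.
  apply: inv_mul_le; rewrite ?ltr0n ?ltr_wpDl// intrB /=.
  have := ler_norm (- (v%:~R - N%:~R) : R); rewrite normrN.
  by rewrite -!pmulrn -[N.+2]addn2 -[v.+1]addn1 !natrD; lra.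
apply: le_trans (ler_sum _ (fun v _ => split_le v)) _.
rewrite -mulr_sumr big_split /= -/S.
(* Folding the sum about [v = N] gives [1 + 2 (1/2 + ... + 1/(N + 1))]. *)
have le2S : \sum_(0 <= v < (2 * N).+1) (`|(v%:Z - N%:Z)%:~R| + 1)^-1 <= 2 * S :> R.
  rewrite (sum_centered (fun n : int => (`|n%:~R| + 1)^-1)) normr0 add0r invr1.
  rewrite (_ : \sum_(1 <= n < N.+1) _ = 2 * \sum_(0 <= n < N) n.+2%:R^-1); last first.
    rewrite mulr_sumr big_add1; apply: eq_big_nat => n _.
    by rewrite mulrNz normrN ger0_norm// -[n.+2]addn1 natrD -!pmulrn mulr_natl mulr2n.
  rewrite /S [in leRHS](big_cat_nat (n := N.+1))//=; last by rewrite ltnS leq_pmull.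
  rewrite [in leRHS]big_nat_recl//= invr1.
  set X := \sum_(0 <= i < N) _; set Y := \sum_(_ <= _ < _) _.
  have Y0 : 0 <= Y by apply: sumr_ge0 => v _; rewrite invr_ge0.
  by lra.
rewrite HE.
apply: le_trans (_ : N.+2%:R^-1 * (3 * S) <= _); first by rewrite ler_wpM2l ?invr_ge0//; lra.
rewrite mulrCA [6 * _]mulrA; rewrite mulrA ler_wpM2r//.
rewrite -[6 * _]invrK invfM invrK -[3 * _]invrK invfM invrK lef_pV2 ?posrE ?mulr_gt0//.
  by rewrite -[N.+2]addn2 -(natr1 (2 * N)) natrM natrD; lra.
all: by rewrite invr_gt0 ltr0n.
Unshelve. all: by end_near.
Qed.

End RealBounds.

(** * Rate of convergence of shifted polylogarithms *)

Section Rates.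
Local Open Scope classical_set_scope.
Variable R : realType.
Implicit Types (z : R[i]) (t : R).

Lemma norm_shifted_term z t s n : `|z| = 1 -> 0 <= t <= 2^-1 ->
  `|z ^+ n.+1 / (n.+1%:R - t%:C) ^+ s| = ((n.+1%:R - t)^-1 ^+ s)%:C.
Proof.
move=> z1 ht; have /andP[pos _] := shifted_inv_le n ht.
rewrite normrM normrX z1 expr1n mul1r -exprVn normrX.
rewrite -(rmorph_nat (real_complex R)) -rmorphB -fmorphV /=.
by rewrite ger0_norm ?ler0c// rmorphXn.
Qed.

(* For [z <> 1], summation by parts through
   [z ^+ j = (z ^+ j - z ^+ j.+1) / (1 - z)]. *)
Lemma shifted_polylog_rate z t s : `|z| = 1 -> 0 <= t <= 2^-1 ->
  (0 < s)%N -> ~ (s = 1%N /\ z = 1) ->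
  exists l C, forall n,
    `|l - \sum_(1 <= j < n.+1) z ^+ j / (j%:R - t%:C) ^+ s| <= (C / n.+1%:R)%:C.
Proof.
move=> z1 ht s0 hsz.
pose b n : R := (n.+1%:R - t)^-1 ^+ s.
have b_ge0 n : 0 <= b n by have /andP[? _] := shifted_inv_le n ht; exact: exprn_ge0.
have b_le m n : (m <= s)%N -> b n <= 2 ^+ s / n.+1%:R ^+ m.
  by move=> ms; apply: expr_inv_le => //; exact: shifted_inv_le.
have [z_eq1|z_neq1] := eqVneq z 1.
  have s2 : (1 < s)%N by case: s s0 hsz {b b_ge0 b_le} => [//|[]//] _ [].
  (* For [z = 1] the exponent is at least [2], and [1/(n + 1)^2 <= 2/((n + 1) (n + 2))] telescopes;
     hence the extra factor [2] in the majorant. *)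
  have [||l hl] := @telescope_majorant _ (fun j => z ^+ j / (j%:R - t%:C) ^+ s)
    (fun n => 2 ^+ s.+1 / n.+1%:R).
  - move=> n; rewrite norm_shifted_term// lecR.
    apply: le_trans (b_le 2%N n s2) _.
    have -> : 2 ^+ s.+1 / n.+1%:R - 2 ^+ s.+1 / n.+2%:R =
        2 ^+ s * (2 / (n.+1%:R * n.+2%:R)) :> R.
      rewrite exprS -[n.+2%:R]natr1; field.
      by rewrite nat1r natr1 !pnatr_eq0.
    rewrite ler_wpM2l ?exprn_ge0// -div1r ler_pdivrMr ?exprn_gt0//.
    rewrite mulrAC ler_pdivlMr ?mulr_gt0// -[n.+2%:R]natr1.
    have : 1 <= n.+1%:R :> R by rewrite ler1n.
    by nra.
  - exact: cvg_divn_succ.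
  by exists l, (2 ^+ s.+1).
have dz0 : 1 - z != 0 by rewrite subr_eq0 eq_sym.
have [c c0 hc] : exists2 c : R, 0 <= c & `|(1 - z)^-1| = c%:C.
  have nr : `|(1 - z)^-1| \is Num.real by exact: normr_real.
  by exists (complex.Re `|(1 - z)^-1|); rewrite -?ler0c (RRe_real nr).
pose Z j := z ^+ j / (1 - z).
have ZE j : `|Z j| = c%:C by rewrite normrM normrX z1 expr1n mul1r hc.
pose B j : R[i] := (b j.-1)%:C.
have BE j : (0 < j)%N -> (j%:R - t%:C)^-1 ^+ s = B j.
  case: j => // j _.
  by rewrite -(rmorph_nat (real_complex R)) -rmorphB -fmorphV /= -rmorphXn.
have b_dec n : b n.+1 <= b n.
  have /andP[p1 _] := shifted_inv_le n ht; have /andP[p2 _] := shifted_inv_le n.+1 ht.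
  have n1 : 1 <= n.+1%:R :> R by rewrite ler1n.
  have /andP[t0 t1] := ht.
  rewrite /b lerXn2r ?nnegrE// lef_pV2 ?posrE -?[n.+2%:R]natr1; lra.
(* [|Z j|] is constant and [b] decreases, so the series left by summation by parts has the
   telescoping majorant [c * b n]. *)
have [||l hl] := @telescope_majorant _ (fun j => Z j.+1 * (B j.+1 - B j)) (fun n => c * b n).
- move=> n; rewrite normrM ZE -mulrBr rmorphM ler_wpM2l ?ler0c//.
  rewrite (_ : B n.+2 - B n.+1 = - (b n - b n.+1)%:C); last by rewrite rmorphB opprB.
  by rewrite normrN ger0_norm ?ler0c ?subr_ge0.
- apply: squeeze_cvgr (cvg_cst 0) (@cvg_divn_succ _ (c * 2 ^+ s)).
  near=> n; rewrite mulr_ge0//= -mulrA ler_wpM2l//.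
  by have := b_le 1%N n s0; rewrite expr1.
(* The constant has one summand for the boundary term [Z n.+1 * B n.+1] and one for the tail. *)
exists (Z 1%N * B 1%N + l), (c * 2 ^+ s + c * 2 ^+ s) => n.
have -> : \sum_(1 <= j < n.+1) z ^+ j / (j%:R - t%:C) ^+ s =
    Z 1%N * B 1%N - Z n.+1 * B n.+1 + \sum_(1 <= j < n.+1) Z j.+1 * (B j.+1 - B j).
  elim: n => [|n IH]; first by rewrite !big_geq// subrr addr0.
  rewrite big_nat_recr//= IH [in RHS]big_nat_recr//= -exprVn BE//.
  have -> : z ^+ n.+1 = Z n.+1 - Z n.+2.
    by rewrite /Z [z ^+ n.+2]exprSr; field.
  by ring.
set S := \sum_(_ <= _ < _) _.
rewrite (_ : _ - _ = Z n.+1 * B n.+1 + (l - S)); last by ring.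
apply: le_trans (ler_normD _ _) _.
rewrite mulrDl rmorphD; have bn : c * b n <= c * 2 ^+ s / n.+1%:R.
  by rewrite -mulrA ler_wpM2l//; have := b_le 1%N n s0; rewrite expr1.
apply: lerD; last by apply: le_trans (hl n) _; rewrite lecR.
rewrite normrM ZE ger0_norm ?ler0c// -rmorphM lecR//.
Unshelve. all: by end_near.
Qed.

End Rates.

(** * Convergence of [ti], [Li] and [Stilde] *)

Section Convergence.
Variable R : realType.
Implicit Types (z : R[i]) (t : R).

Lemma halfC : 2^-1 = (2^-1)%:C :> R[i].
Proof. by rewrite fmorphV rmorph_nat. Qed.

Lemma half_itv : 0 <= (2^-1 : R) <= 2^-1.
Proof. by rewrite lexx invr_ge0 ler0n. Qed.

Lemma clim_rate (u : nat -> R[i]) l (K : R) :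
  (forall n, `|l - u n| <= (K / n.+1%:R)%:C) -> clim u l.
Proof. by move=> h; apply: clim_bound h _; exact: cvg_divn_succ. Qed.

Lemma tpart_rate z s : `|z| = 1 -> (0 < s)%N -> ~ (s = 1%N /\ z = 1) ->
  exists K : R, forall n, `|ti s z - tpart n s z| <= (K / n.+1%:R)%:C.
Proof.
move=> z1 s0 hsz; have [l [K hl]] := shifted_polylog_rate z1 half_itv s0 hsz.
exists K; suff -> : ti s z = l by move=> n; rewrite /tpart halfC; exact: hl.
by apply: clim_csum; rewrite halfC; exact: clim_rate hl.
Qed.

Lemma clim_ti z s : `|z| = 1 -> (0 < s)%N -> ~ (s = 1%N /\ z = 1) ->
  clim (fun N => tpart N s z) (ti s z).
Proof. by move=> z1 s0 hsz; have [K /clim_rate] := tpart_rate z1 s0 hsz. Qed.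

Lemma clim_Li z s : `|z| = 1 -> (0 < s)%N -> ~ (s = 1%N /\ z = 1) ->
  clim (fun N => \sum_(1 <= n < N.+1) z ^+ n / n%:R ^+ s) (Li s z).
Proof.
move=> z1 s0 hsz; have t0 : 0 <= (0 : R) <= 2^-1 by rewrite lexx invr_ge0 ler0n.
have [l [K /clim_rate]] := shifted_polylog_rate z1 t0 s0 hsz.
rewrite rmorph0; under eq_fun do under eq_bigr do rewrite subr0.
by move=> hl; rewrite /Li (clim_csum hl).
Qed.

(** Since [tpart n] is [ti] up to [O(1/n)], the series is [ti * Li] minus a series with terms
    [O(1/n^2)]. *)
Lemma clim_Stilde z1 z p q : `|z1| = 1 -> `|z| = 1 -> (0 < p)%N -> (0 < q)%N ->
  ~ (p = 1%N /\ z1 = 1) -> ~ (q = 1%N /\ z = 1) ->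
  clim (fun N => \sum_(1 <= n < N.+1) tpart n p z1 / n%:R ^+ q * z ^+ n)
       (Stilde p q z1 z).
Proof.
move=> hz1 hz p0 q0 hp hq; have [K hK] := tpart_rate hz1 p0 hp.
pose e n := (ti p z1 - tpart n p z1) / n%:R ^+ q * z ^+ n.
have [||l hl] := @telescope_majorant _ e (fun n => K / n.+1%:R).
- move=> n; rewrite !normrM !normrX normfV normrX hz expr1n mulr1 normr_nat.
  apply: le_trans (_ : (K / n.+2%:R)%:C * (n.+1%:R^-1)%:C <= _).
    apply: ler_pM (hK _) _ => //; first by rewrite invr_ge0 exprn_ge0.
    rewrite fmorphV rmorph_nat lef_pV2 ?posrE ?exprn_gt0 ?ltr0n//.
    by rewrite -[leLHS]expr1 ler_weXn2l// ler1n.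
  rewrite -rmorphM lecR le_eqVlt; apply/orP; left; apply/eqP.
  by rewrite -[n.+2%:R]natr1; field; rewrite nat1r natr1 !pnatr_eq0.
- exact: cvg_divn_succ.
suff h : clim (fun N => \sum_(1 <= n < N.+1) tpart n p z1 / n%:R ^+ q * z ^+ n)
    (ti p z1 * Li q z - l) by rewrite /Stilde (clim_csum h).
have := climB (climM (clim_cst (ti p z1)) (clim_Li hz q0 hq)) (clim_rate hl).
apply: eq_clim => N.
by rewrite mulr_sumr -sumrB; apply: eq_big_nat => n _; rewrite /e; ring.
Qed.

End Convergence.

(** * Bilateral summands, and partial sums replaced by their limits *)

Section Kernel.
Local Open Scope classical_set_scope.
Variable R : realType.
Implicit Types (x : R[i]) (t : R) (n : int).

(** [t = 0] gives the summands of [Li], [t = 1/2] those of [ti]. For [t = 0] and [i > 0] the value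
    at [n = 0] is [0] because [0^-1 = 0], so that index drops out by itself. *)
Definition kernel t i x n : R[i] := x ^ (- n) / (n%:~R - t%:C) ^+ i.

Lemma norm_real_complex (r : R) : `|r%:C| = `|r|%:C.
Proof. by rewrite normc_def /= expr0n addr0 sqrtr_sqr. Qed.

Lemma norm_exprz x n : `|x| = 1 -> `|x ^ n| = 1.
Proof.
by move=> x1; case: n => n; rewrite /exprz ?normfV normrX x1 expr1n// invr1.
Qed.

(* At [n = 0, t = 0] the left-hand side is [0^-1 = 0]. *)
Lemma inv_int_sub_le t n : t = 0 \/ t = 2^-1 ->
  `|n%:~R - t|^-1 <= 4 / (`|n%:~R| + 1).
Proof.
move=> ht; have [->|n0] := eqVneq n 0.
  rewrite [`|0%:~R|]normr0 [0 + 1]add0r divr1 sub0r normrN; case: ht => ->.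
    by rewrite normr0 invr0; lra.
  by rewrite gtr0_norm ?invr_gt0 ?ltr0n// invrK; lra.
have n1 : 1 <= `|n%:~R : R| by rewrite -intr_norm ler1z; lia.
(* The constant [4] is attained at [n = 1], [t = 1/2]. *)
have le4 : (`|n%:~R : R| + 1) / 4 <= `|n%:~R - t|.
  have := lerB_dist n%:~R t.
  case: ht => ->; first by rewrite normr0; lra.
  by rewrite [`|2^-1|]gtr0_norm ?invr_gt0 ?ltr0n//; lra.
by rewrite -[4 / _]invrK invfM invrK lef_pV2 ?posrE; lra.
Qed.

Lemma kernel_bound t i x n : t = 0 \/ t = 2^-1 -> (0 < i)%N -> `|x| = 1 ->
  `|kernel t i x n| <= (4 ^+ i / (`|n%:~R| + 1))%:C.
Proof.
move=> ht i0 x1; rewrite normrM norm_exprz// mul1r normfV normrX.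
rewrite -(rmorph_int (real_complex R)) -rmorphB norm_real_complex -rmorphXn.
rewrite -fmorphV lecR -exprVn.
have a1 : 1 <= `|n%:~R : R| + 1 by rewrite lerDr.
apply: le_trans (_ : (4 / (`|n%:~R| + 1)) ^+ i <= _).
  by rewrite lerXn2r ?nnegrE ?invr_ge0 ?divr_ge0 ?inv_int_sub_le//; lra.
rewrite expr_div_n ler_wpM2l ?exprn_ge0// lef_pV2 ?posrE ?exprn_gt0; [|lra..].
by rewrite -[leLHS]expr1 ler_weXn2l.
Qed.

(** The bound on [h] peaks at [v = N], that on [L - P v] at [v = 0]; the error is at most [D * K]
    times the harmonic convolution. *)
Lemma clim_weighted_sum (h : int -> R[i]) (P : nat -> R[i]) (H L : R[i]) (D K : R) :
  (forall n, `|h n| <= (D / (`|n%:~R| + 1))%:C) ->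
  (forall n : nat, `|L - P n| <= (K / n.+1%:R)%:C) ->
  clim (fun N => \sum_(0 <= v < (2 * N).+1) h (v%:Z - N%:Z)) H ->
  clim (fun N => \sum_(0 <= v < (2 * N).+1) h (v%:Z - N%:Z) * P v) (H * L).
Proof.
move=> hh hP hH.
have err0 : clim (fun N => \sum_(0 <= v < (2 * N).+1) h (v%:Z - N%:Z) * (L - P v)) 0.
  apply: (@clim_bound _ _ _ (fun N => D * K * \sum_(0 <= v < (2 * N).+1)
     (`|(v%:Z - N%:Z)%:~R| + 1)^-1 / v.+1%:R)).
    move=> N; rewrite sub0r normrN; apply: le_trans (ler_norm_sum _ _ _) _.
    rewrite mulr_sumr rmorph_sum; apply: ler_sum => v _; rewrite normrM.
    apply: le_trans (ler_pM _ _ (hh _) (hP _)) _ => //.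
    by rewrite -rmorphM lecR le_eqVlt; apply/orP; left; apply/eqP; ring.
  rewrite -[X in _ --> X](mulr0 (D * K)).
  exact: cvgMl_tmp (@cvg_convolution_harmonic R).
have := climB (climM hH (clim_cst L)) err0; rewrite subr0; apply: eq_clim => N.
by rewrite mulr_suml -sumrB; apply: eq_bigr => v _; ring.
Qed.

End Kernel.

(** * Symmetric bilateral sums and weighted triangles *)

Section SymmetricSums.
Variable R : realType.
Implicit Types (x : R[i]).

Lemma kernel0_nat i x n : kernel 0 i x n%:Z = x^-1 ^+ n / n%:R ^+ i.
Proof. by rewrite /kernel rmorph0 subr0 exprVn -exprnN. Qed.

Lemma kernel0_opp i x n : kernel 0 i x (- n%:Z) = (-1) ^+ i * (x ^+ n / n%:R ^+ i).
Proof.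
rewrite /kernel rmorph0 subr0 opprK mulrNz -pmulrn -[- n%:R]mulN1r exprMn invfM.
by rewrite -[((-1) ^+ i)^-1]exprVn invrN1 mulrCA.
Qed.

Lemma kernel0_0 i x : (0 < i)%N -> kernel 0 i x 0 = 0.
Proof. by move=> i0; rewrite /kernel rmorph0 subr0 expr0n gtn_eqF// invr0 mulr0. Qed.

Lemma kernel_half_nat i x n : kernel 2^-1 i x n%:Z = x^-1 ^+ n / (n%:R - 2^-1) ^+ i.
Proof. by rewrite /kernel -halfC exprVn -exprnN. Qed.

Lemma kernel_half_refl i x n : x != 0 ->
  kernel 2^-1 i x (1 - n%:Z) = (-1) ^+ i * x^-1 * (x ^+ n / (n%:R - 2^-1) ^+ i).
Proof.
move=> x0; rewrite /kernel -halfC opprB expfzDr// exprN1 intrB.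
have -> : 1%:~R - n%:~R - 2^-1 = -1 * (n%:R - 2^-1) :> R[i].
  by rewrite -pmulrn; field.
by rewrite exprMn invfM -[((-1) ^+ i)^-1]exprVn invrN1 -exprnP; ring.
Qed.

Lemma clim_sum_kernel0 i x : `|x| = 1 -> (0 < i)%N ->
  clim (fun N => \sum_(0 <= u < (2 * N).+1) kernel 0 i x (u%:Z - N%:Z))
    (Li i x^-1 + (-1) ^+ i * Li i x).
Proof.
move=> x1 i0.
have sumE N : \sum_(0 <= u < (2 * N).+1) kernel 0 i x (u%:Z - N%:Z) =
    \sum_(1 <= n < N.+1) x^-1 ^+ n / n%:R ^+ i +
    (-1) ^+ i * \sum_(1 <= n < N.+1) x ^+ n / n%:R ^+ i.
  rewrite sum_centered kernel0_0// add0r mulr_sumr -big_split /=.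
  by apply: eq_bigr => n _; rewrite kernel0_nat kernel0_opp.
(* For [i = 1], [x = 1] the paired terms cancel for every [N], and the claimed limit is [0] whatever
   the unspecified value of [Li 1 1]. *)
have [[i1 xE]|hix] := EM (i = 1%N /\ x = 1).
  subst i x; rewrite invr1 expr1 mulN1r subrr; apply: eq_clim (clim_cst 0) => N.
  by rewrite sumE invr1 expr1 mulN1r subrr.
apply: (eq_clim (fun N => esym (sumE N))).
apply: climD; last by apply: climM (clim_cst _) _; exact: clim_Li.
apply: clim_Li => //; first by rewrite normfV x1 invr1.
by case=> i1 /eqP; rewrite invr_eq1 => /eqP xE; apply: hix.
Qed.

Lemma clim_sum_kernel_half i x : `|x| = 1 -> (0 < i)%N ->
  clim (fun N => \sum_(0 <= u < (2 * N).+1) kernel 2^-1 i x (u%:Z - N%:Z))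
    (ti i x^-1 + (-1) ^+ i * x^-1 * ti i x).
Proof.
move=> x1 i0; have x0 : x != 0 by rewrite -normr_eq0 x1 oner_eq0.
have half : 2^-1 = 0 :> R \/ 2^-1 = 2^-1 :> R by right.
(* The unpaired end [- N] is negligible. *)
have edge0 : clim (fun N => kernel 2^-1 i x (- N%:Z)) 0.
  apply: (@clim_rate _ _ _ (4 ^+ i)) => N; rewrite sub0r normrN.
  have := kernel_bound (- N%:Z) half i0 x1.
  by rewrite mulrNz normrN -pmulrn normr_nat natr1.
have sumE N : \sum_(0 <= u < (2 * N).+1) kernel 2^-1 i x (u%:Z - N%:Z) =
    kernel 2^-1 i x (- N%:Z) + (tpart N i x^-1 + (-1) ^+ i * x^-1 * tpart N i x).
  rewrite sum_centered_half mulr_sumr -big_split /=; congr (_ + _).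
  by apply: eq_bigr => n _; rewrite kernel_half_nat kernel_half_refl.
apply: (eq_clim (fun N => esym (sumE N))); rewrite -[X in clim _ X]add0r.
apply: climD edge0 _.
have [[i1 xE]|hix] := EM (i = 1%N /\ x = 1).
  rewrite i1 xE invr1 expr1 mulr1 mulN1r subrr; apply: eq_clim (clim_cst 0) => N.
  by rewrite mulN1r subrr.
apply: climD; last by apply: climM (clim_cst _) _; exact: clim_ti.
apply: clim_ti => //; first by rewrite normfV x1 invr1.
by case=> i1 /eqP; rewrite invr_eq1 => /eqP xE; apply: hix.
Qed.

(** The inner sum is the partial sum of [ti] of length [2 N - u]. Reversing [u] makes that length
    the index and replaces [g n] by [g (- n)]. *)
Lemma clim_triangle_left (g : int -> R[i]) (G : R[i]) (D : R) z s :
  (forall n, `|g n| <= (D / (`|n%:~R| + 1))%:C) ->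
  clim (fun N => \sum_(0 <= u < (2 * N).+1) g (u%:Z - N%:Z)) G ->
  `|z| = 1 -> (0 < s)%N -> ~ (s = 1%N /\ z = 1) ->
  clim (fun N => \sum_(0 <= u < (2 * N).+1) \sum_(u.+1 <= v < (2 * N).+1)
    z ^+ (v - u) / ((v - u)%:R - 2^-1) ^+ s * g (u%:Z - N%:Z)) (G * ti s z).
Proof.
move=> hg hG z1 s0 hsz; have [K hK] := tpart_rate z1 s0 hsz.
have revE N (f : int -> nat -> R[i]) :
    \sum_(0 <= u < (2 * N).+1) f (u%:Z - N%:Z) (2 * N - u)%N =
    \sum_(0 <= v < (2 * N).+1) f (- (v%:Z - N%:Z)) v.
  by rewrite big_nat_rev /=; apply: eq_big_nat => v lt_v; congr f; lia.
have := @clim_weighted_sum _ (fun n => g (- n)) _ G _ D K _ hK.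
have h1 : forall n : int, `|g (- n)| <= (D / (`|n%:~R| + 1))%:C.
  by move=> n; have := hg (- n); rewrite mulrNz normrN.
have h2 : clim (fun N => \sum_(0 <= v < (2 * N).+1) g (- (v%:Z - N%:Z))) G.
  by apply: eq_clim hG => N; rewrite -(revE N (fun n _ => g n)).
move=> /(_ h1 h2); apply: eq_clim => N; rewrite -(revE N (fun n k => g n * tpart k s z)).
apply: eq_big_nat => u lt_u; rewrite -mulr_suml mulrC; congr (_ * _).
rewrite (sum_shift_sub (fun j => z ^+ j / (j%:R - 2^-1) ^+ s)) /tpart.
by rewrite subSn//; lia.
Qed.

(** With the order of summation exchanged, the inner sum over [u < v] is the partial sum of [ti] of
    length [v]. *)
Lemma clim_triangle_right (h : int -> R[i]) (H : R[i]) (D : R) z s :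
  (forall n, `|h n| <= (D / (`|n%:~R| + 1))%:C) ->
  clim (fun N => \sum_(0 <= v < (2 * N).+1) h (v%:Z - N%:Z)) H ->
  `|z| = 1 -> (0 < s)%N -> ~ (s = 1%N /\ z = 1) ->
  clim (fun N => \sum_(0 <= u < (2 * N).+1) \sum_(u.+1 <= v < (2 * N).+1)
    z ^+ (v - u) / ((v - u)%:R - 2^-1) ^+ s * h (v%:Z - N%:Z)) (H * ti s z).
Proof.
move=> hh hH z1 s0 hsz; have [K hK] := tpart_rate z1 s0 hsz.
have := clim_weighted_sum hh hK hH; apply: eq_clim => N.
rewrite exchange_triangle; apply: eq_big_nat => v _.
rewrite -mulr_suml mulrC; congr (_ * _).
by rewrite (sum_rev_sub (fun j => z ^+ j / (j%:R - 2^-1) ^+ s)).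
Qed.

End SymmetricSums.

(** * The triangle sum and its summation over [k] first *)

Section Triangle.
Variable R : realType.
Implicit Types (x y : R[i]).

Lemma int_sub_half_neq0 (n : int) : n%:~R - 2^-1 != 0 :> R[i].
Proof.
apply/eqP => /(congr1 ( *%R^~ 2)); rewrite mul0r mulrBl mulVf ?pnatr_eq0//.
move/eqP; rewrite -[1]/(1%:~R) -[2]/(2%:~R) -intrM -intrB intr_eq0.
by move=> /eqP; lia.
Qed.

(** For [n <> 0] this is the partial fraction expansion with [1/n], [1/(k - 1/2)] and [1/(j - 1/2)].
    The last term corrects [n = 0], where the product vanishes but the second sum does not. *)
Lemma kernel_mul_decomp x y P Q (n k : int) (j : nat) : x != 0 -> y != 0 -> k = n + j ->
  kernel 0 Q.+1 (x * y) n * kernel 2^-1 P.+1 y^-1 k =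
  \sum_(0 <= m < Q.+1) (-1) ^+ (Q - m) * 'C(P + Q - m, P)%:R *
    (y ^+ j / (j%:R - 2^-1) ^+ (P + Q - m).+1 * kernel 0 m.+1 x n) +
  \sum_(0 <= m < P.+1) (-1) ^+ Q.+1 * 'C(P + Q - m, Q)%:R *
    ((x * y) ^+ j / (j%:R - 2^-1) ^+ (P + Q - m).+1 * kernel 2^-1 m.+1 x k) -
  (if n == 0 then (-1) ^+ Q.+1 * 'C(P + Q + 1, P)%:R *
    (y ^+ j / (j%:R - 2^-1) ^+ (P + Q).+2) else 0).
Proof.
move=> x0 y0 kE.
pose b : R[i] := n%:~R^-1; pose c : R[i] := (k%:~R - 2^-1)^-1.
pose e : R[i] := (j%:R - 2^-1)^-1; pose X := x ^ (- n) * y ^+ j.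
have k0 : k%:~R - 2^-1 != 0 :> R[i] by exact: int_sub_half_neq0.
have j0 : j%:R - 2^-1 != 0 :> R[i] by exact: int_sub_half_neq0 j.
(* The common factor has two forms: [y ^ j] against [x ^ (- n)], and [(x y) ^ j] against
   [x ^ (- k)]. *)
have XE : (x * y) ^+ j * x ^ (- k) = X.
  rewrite kE opprD expfzDr// -exprnN exprMn /X; field.
  by rewrite expf_neq0.
have termA m s : y ^+ j / (j%:R - 2^-1) ^+ s * kernel 0 m x n = X * (e ^+ s * b ^+ m).
  by rewrite /kernel rmorph0 subr0 /X /e /b !exprVn; ring.
have termB m s : (x * y) ^+ j / (j%:R - 2^-1) ^+ s * kernel 2^-1 m x k = X * (e ^+ s * c ^+ m).
  by rewrite /kernel -halfC -XE /e /c !exprVn; ring.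
have -> : kernel 0 Q.+1 (x * y) n * kernel 2^-1 P.+1 y^-1 k = X * (b ^+ Q.+1 * c ^+ P.+1).
  rewrite /kernel rmorph0 subr0 -halfC.
  have -> : (x * y) ^ (- n) / n%:~R ^+ Q.+1 * (y^-1 ^ (- k) / (k%:~R - 2^-1) ^+ P.+1) =
     ((x * y) ^ (- n) * y^-1 ^ (- k)) * (b ^+ Q.+1 * c ^+ P.+1).
    by rewrite /b /c !exprVn; ring.
  congr (_ * _); rewrite /X expfzMl exprz_inv opprK kE expfzDr// -!exprnP.
  by rewrite -mulrA [y ^ _ * (_ * _)]mulrA -expfzDr// addNr expr0z mul1r.
under eq_bigr do rewrite termA.
under [X in _ + X - _]eq_bigr do rewrite termB.
have [n0|n0] := eqVneq n 0.
  have b0 : b = 0 by rewrite /b n0 invr0.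
  have ce : c = e by rewrite /c /e kE n0 add0r -pmulrn.
  rewrite b0 expr0n mul0r mulr0 big1 ?add0r => [|m _]; last by rewrite expr0n !mulr0.
  apply/esym/eqP; rewrite subr_eq0; apply/eqP.
  rewrite -hockey_stick natr_sum mulr_sumr mulr_suml; apply: eq_big_nat => m lt_m.
  rewrite ce -exprD (_ : (P + Q - m).+1 + m.+1 = (P + Q).+2)%N; last by lia.
  by rewrite /X n0 expr0z mul1r /e exprVn.
have bce : b * c = e * (b - c).
  have n0' : n%:~R != 0 :> R[i] by rewrite intr_eq0.
  move: k0; rewrite /b /c /e kE intrD -pmulrn -addrA => k0.
  move: j0 k0; set a := j%:R - _; clearbody a => j0 k0.
  by field; apply/and3P.
rewrite subr0 (partial_fraction P Q bce) mulrDr !mulr_sumr.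
by congr (_ + _); apply: eq_bigr => m _; ring.
Qed.

Definition triangle_sum p q x y N : R[i] :=
  \sum_(0 <= u < (2 * N).+1) \sum_(u.+1 <= v < (2 * N).+1)
    kernel 0 q (x * y) (u%:Z - N%:Z) * kernel 2^-1 p y^-1 (v%:Z - N%:Z).

(** The indices [k <= 0] are reflected by [k -> 1 - k], which sends [k - 1/2] to its opposite. *)
Lemma sum_kernel_half_gt p y N u : y != 0 -> (u <= 2 * N)%N ->
  \sum_(u.+1 <= v < (2 * N).+1) kernel 2^-1 p y^-1 (v%:Z - N%:Z) =
  tpart N p y + (if (N <= u)%N then - tpart (u - N) p y
                 else (-1) ^+ p * y * tpart (N - u) p y^-1).
Proof.
move=> y0 le_u.
have pos m : (m <= N)%N -> \sum_((m + N).+1 <= v < (2 * N).+1) kernel 2^-1 p y^-1 (v%:Z - N%:Z) =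
    tpart N p y - tpart m p y.
  move=> le_m; rewrite -addSn big_addn (_ : (2 * N).+1 - N = N.+1)%N; last by lia.
  rewrite /tpart [in RHS](big_cat_nat (n := m.+1))//= addrAC subrr add0r.
  apply: eq_big_nat => k _.
  by rewrite (_ : (k + N)%:Z - N%:Z = k%:Z) ?kernel_half_nat ?invrK//; lia.
case: leqP => [le_Nu|lt_uN].
  by rewrite -pos; [rewrite subnK|lia].
rewrite (big_cat_nat (n := N.+1))//=; [|lia..].
have tpart0 : tpart 0 p y = 0 by rewrite /tpart big_geq.
rewrite (pos 0%N)// tpart0 subr0 addrC; congr (_ + _).
rewrite -[u.+1]add1n big_addn (_ : N.+1 - u = (N - u).+1)%N; last by lia.
rewrite big_nat_rev /= /tpart mulr_sumr; apply: eq_big_nat => l lt_l.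
rewrite -[y in (-1) ^+ p * y]invrK -kernel_half_refl ?invr_neq0//.
by congr kernel; lia.
Qed.

(** In the inner sum the part [tpart N p y], independent of [n], yields the products; the rest
    yields one [Stilde] for [n > 0] and the other for [n < 0]. *)
Lemma triangle_sumE p q x y N : y != 0 -> (0 < q)%N ->
  triangle_sum p q x y N =
  tpart N p y * (\sum_(1 <= n < N.+1) (x * y)^-1 ^+ n / n%:R ^+ q +
                 (-1) ^+ q * \sum_(1 <= n < N.+1) (x * y) ^+ n / n%:R ^+ q)
  - \sum_(1 <= n < N.+1) tpart n p y / n%:R ^+ q * (x * y)^-1 ^+ n
  + (-1) ^+ (p + q) * y *
    \sum_(1 <= n < N.+1) tpart n p y^-1 / n%:R ^+ q * (x * y) ^+ n.
Proof.
move=> y0 q0; rewrite /triangle_sum.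
pose T (n : int) := tpart N p y + (if 0 <= n then - tpart `|n| p y
                                   else (-1) ^+ p * y * tpart `|n| p y^-1).
transitivity (\sum_(0 <= u < (2 * N).+1)
    kernel 0 q (x * y) (u%:Z - N%:Z) * T (u%:Z - N%:Z)).
  apply: eq_big_nat => u /andP[_ lt_u]; rewrite -mulr_sumr sum_kernel_half_gt//.
  rewrite /T (_ : (0 <= u%:Z - N%:Z) = (N <= u)%N); last by lia.
  have [le|lt] := leqP N u.
    by rewrite (_ : `|u%:Z - N%:Z|%N = (u - N)%N)//; lia.
  by rewrite (_ : `|u%:Z - N%:Z|%N = (N - u)%N)//; lia.
rewrite (sum_centered (fun n => kernel 0 q (x * y) n * T n)) kernel0_0// mul0r add0r.
rewrite mulrDr !mulr_sumr -sumrN -!big_split /=; apply: eq_big_nat => n /andP[n1 _].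
rewrite kernel0_nat kernel0_opp /T abszN absz_nat /= (_ : 0 <= - n%:Z = false); last by lia.
by rewrite exprD; ring.
Qed.

End Triangle.

(** * The two limits of the triangle sum *)

Section TriangleLimits.
Variable R : realType.
Implicit Types (x y : R[i]).

Lemma clim_triangle_sum_Stilde p q x y : `|x| = 1 -> `|y| = 1 ->
  (0 < p)%N -> (0 < q)%N -> ~ (p = 1%N /\ y = 1) -> ~ (q = 1%N /\ x * y = 1) ->
  clim (triangle_sum p q x y)
    (ti p y * (Li q (x * y)^-1 + (-1) ^+ q * Li q (x * y))
     - Stilde p q y (x * y)^-1 + (-1) ^+ (p + q) * y * Stilde p q y^-1 (x * y)).
Proof.
move=> x1 y1 p0 q0 hpy hqw.
have y0 : y != 0 by rewrite -normr_eq0 y1 oner_eq0.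
have w1 : `|x * y| = 1 by rewrite normrM x1 y1 mulr1.
have inv_norm z : `|z| = 1 -> `|z^-1| = 1 :> R[i].
  by move=> z1; rewrite normfV z1 invr1.
have inv_neq1 s z : ~ (s = 1%N /\ z = 1) -> ~ (s = 1%N /\ z^-1 = 1 :> R[i]).
  by move=> h [s1 /eqP]; rewrite invr_eq1 => /eqP z1; apply: h.
apply: (eq_clim (fun N => esym (triangle_sumE p x N y0 q0))).
apply: climD; last first.
  by apply: climM (clim_cst _) _; apply: clim_Stilde; auto.
apply: climB; last by apply: clim_Stilde; auto.
apply: climM; first exact: clim_ti.
apply: climD; first by apply: clim_Li; auto.
by apply: climM (clim_cst _) _; apply: clim_Li.
Qed.

Lemma triangle_sum_decomp P Q x y N : x != 0 -> y != 0 ->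
  triangle_sum P.+1 Q.+1 x y N =
  \sum_(0 <= m < Q.+1) (-1) ^+ (Q - m) * 'C(P + Q - m, P)%:R *
    (\sum_(0 <= u < (2 * N).+1) \sum_(u.+1 <= v < (2 * N).+1)
      y ^+ (v - u) / ((v - u)%:R - 2^-1) ^+ (P + Q - m).+1 *
      kernel 0 m.+1 x (u%:Z - N%:Z)) +
  \sum_(0 <= m < P.+1) (-1) ^+ Q.+1 * 'C(P + Q - m, Q)%:R *
    (\sum_(0 <= u < (2 * N).+1) \sum_(u.+1 <= v < (2 * N).+1)
      (x * y) ^+ (v - u) / ((v - u)%:R - 2^-1) ^+ (P + Q - m).+1 *
      kernel 2^-1 m.+1 x (v%:Z - N%:Z)) -
  (-1) ^+ Q.+1 * 'C(P + Q + 1, P)%:R * tpart N (P + Q).+2 y.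
Proof.
move=> x0 y0.
have exchange (c : nat -> R[i]) (F : nat -> nat -> nat -> R[i]) M K :
    \sum_(0 <= m < K) c m * (\sum_(0 <= u < M) \sum_(u.+1 <= v < M) F m u v) =
    \sum_(0 <= u < M) \sum_(u.+1 <= v < M) \sum_(0 <= m < K) c m * F m u v.
  under eq_bigr do rewrite mulr_sumr; rewrite exchange_big; apply: eq_bigr => u _ /=.
  by under eq_bigr do rewrite mulr_sumr; rewrite exchange_big.
(* The correction lives on the row [u = N], that is [n = 0]. *)
have -> : (-1) ^+ Q.+1 * 'C(P + Q + 1, P)%:R * tpart N (P + Q).+2 y =
    \sum_(0 <= u < (2 * N).+1) \sum_(u.+1 <= v < (2 * N).+1)
      (if u%:Z - N%:Z == 0 then (-1) ^+ Q.+1 * 'C(P + Q + 1, P)%:R *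
        (y ^+ (v - u) / ((v - u)%:R - 2^-1) ^+ (P + Q).+2) else 0).
  rewrite (big_cat_nat (n := N.+1))//=; last by lia.
  rewrite big_nat_recr//= big_nat_cond big1 ?add0r => [|u]; last first.
    rewrite andbT => /andP[_ lt_u]; rewrite big1// => v _.
    by rewrite ifF//; apply/eqP; lia.
  rewrite [X in _ + X]big_nat_cond [X in _ + X]big1 ?addr0 => [|u]; last first.
    rewrite andbT => /andP[lt_u _]; rewrite big1// => v _.
    by rewrite ifF//; apply/eqP; lia.
  rewrite subrr eqxx -mulr_sumr (sum_shift_sub (fun j => y ^+ j / (j%:R - 2^-1) ^+ (P + Q).+2)).
  by rewrite (_ : (2 * N).+1 - N = N.+1)%N; last by lia.
rewrite !exchange -big_split /= -sumrB; apply: eq_big_nat => u _.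
rewrite -big_split /= -sumrB; apply: eq_big_nat => v /andP[lt_uv _].
by apply: kernel_mul_decomp => //; lia.
Qed.

(** The exponent [(P + Q - m).+1] is [1] only for [P = 0], [m = Q] in the first sum and [Q = 0],
    [m = P] in the second; the hypotheses then exclude [y = 1] and [x * y = 1]. *)
Lemma clim_triangle_sum_decomp P Q x y : `|x| = 1 -> `|y| = 1 ->
  ~ (P = 0%N /\ y = 1) -> ~ (Q = 0%N /\ x * y = 1) ->
  clim (triangle_sum P.+1 Q.+1 x y)
    (\sum_(0 <= m < Q.+1) (-1) ^+ (Q - m) * 'C(P + Q - m, P)%:R *
       ((Li m.+1 x^-1 + (-1) ^+ m.+1 * Li m.+1 x) * ti (P + Q - m).+1 y) +
     \sum_(0 <= m < P.+1) (-1) ^+ Q.+1 * 'C(P + Q - m, Q)%:R *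
       ((ti m.+1 x^-1 + (-1) ^+ m.+1 * x^-1 * ti m.+1 x) *
        ti (P + Q - m).+1 (x * y)) -
     (-1) ^+ Q.+1 * 'C(P + Q + 1, P)%:R * ti (P + Q).+2 y).
Proof.
move=> x1 y1 hPy hQw.
have x0 : x != 0 by rewrite -normr_eq0 x1 oner_eq0.
have y0 : y != 0 by rewrite -normr_eq0 y1 oner_eq0.
have w1 : `|x * y| = 1 by rewrite normrM x1 y1 mulr1.
apply: (eq_clim (fun N => esym (triangle_sum_decomp P Q N x0 y0))).
apply: climB; last by apply: climM (clim_cst _) _; apply: clim_ti => //; case.
apply: climD; apply: clim_sum => m /andP[_ lt_m]; apply: climM (clim_cst _) _.
- apply: (@clim_triangle_left _ _ _ (4 ^+ m.+1)) => //.
  + by move=> n; apply: kernel_bound => //; left.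
  + exact: clim_sum_kernel0.
  + by case=> s1 yE; apply: hPy; split=> //; lia.
- apply: (@clim_triangle_right _ _ _ (4 ^+ m.+1)) => //.
  + by move=> n; apply: kernel_bound => //; right.
  + exact: clim_sum_kernel_half.
  + by case=> s1 wE; apply: hQw; split=> //; lia.
Qed.

End TriangleLimits.

(* For x = 1 the divergent ti 1 1 and Li 1 1 occur on the right-hand side, but
   only in the m = 0 differences, which are then of the form a - a = 0. *)
Theorem theorem4p1 (R : realType) (x y : R[i]) (p q : nat)
  (hx : root_of_unity x) (hy : root_of_unity y)
  (hp : (1 <= p)%N) (hq : (1 <= q)%N)
  (hpy : ~ (p = 1%N /\ y = 1)) (hqxy : ~ (q = 1%N /\ x * y = 1)) :
  y^-1 * Stilde p q y (x * y)^-1 - (-1) ^+ (p + q) * Stilde p q y^-1 (x * y)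
  = y^-1 * Li q (x * y)^-1 * ti p y
    + (-1) ^+ q * y^-1 * Li q (x * y) * ti p y
    + (-1) ^+ q * 'C(p + q - 1, p - 1)%:R * y^-1 * ti (p + q) y
    + (-1) ^+ q * (x * y)^-1 *
      (\sum_(0 <= m < p)
         'C(p + q - m - 2, q - 1)%:R * ti (p + q - m - 1) (x * y) *
         ((-1) ^+ m * ti (m + 1) x - x * ti (m + 1) x^-1))
    + (-1) ^+ q * y^-1 *
      (\sum_(0 <= m < q)
         'C(p + q - m - 2, p - 1)%:R * ti (p + q - m - 1) y *
         ((-1) ^+ m * Li (m + 1) x^-1 - Li (m + 1) x)).
Proof.
have x1 := norm_root_of_unity hx; have y1 := norm_root_of_unity hy.
have x0 : x != 0 by rewrite -normr_eq0 x1 oner_eq0.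
have y0 : y != 0 by rewrite -normr_eq0 y1 oner_eq0.
have := clim_triangle_sum_Stilde x1 y1 hp hq hpy hqxy.
case: p q hp hq hpy hqxy => [//|P] [//|Q] _ _ hpy hqxy hS.
have hPy : ~ (P = 0%N /\ y = 1) by case=> P0 yE; apply: hpy; rewrite P0.
have hQw : ~ (Q = 0%N /\ x * y = 1) by case=> Q0 wE; apply: hqxy; rewrite Q0.
(* The two evaluations of one limit agree; it remains to match signs and indices. *)
have := clim_unique hS (clim_triangle_sum_decomp x1 y1 hPy hQw).
set A := \sum_(0 <= m < Q.+1) _; set B := \sum_(0 <= m < P.+1) _.
set C := 'C(P + Q + 1, P)%:R.
have -> : 'C(P.+1 + Q.+1 - 1, P.+1 - 1)%:R = C by rewrite /C; congr ('C(_, _)%:R); lia.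
have -> : (P.+1 + Q.+1 = (P + Q).+2)%N by lia.
set B' := \sum_(0 <= m < P.+1) _; set A' := \sum_(0 <= m < Q.+1) _.
have AE : A = - (-1) ^+ Q.+1 * A'.
  rewrite /A /A' mulr_sumr; apply: eq_big_nat => m /andP[_ lt_m].
  have -> : ((P + Q).+2 - m - 2 = P + Q - m)%N by lia.
  have -> : ((P + Q).+2 - m - 1 = (P + Q - m).+1)%N by lia.
  have -> : (-1) ^+ Q.+1 = - ((-1) ^+ (Q - m) * (-1) ^+ m) :> R[i].
    by rewrite -exprD subnK// exprS mulN1r.
  (* A square of the sign [(-1) ^+ m] is inserted so that it can be factored out of both [Li]
     terms. *)
  have LE : Li m.+1 x^-1 = (-1) ^+ m * (-1) ^+ m * Li m.+1 x^-1.
    by rewrite -expr2 sqrr_sign mul1r.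
  by rewrite subn1 addn1 /= [in LHS]LE [(-1) ^+ m.+1]exprS; ring.
have BE : B = - (-1) ^+ Q.+1 * x^-1 * B'.
  rewrite /B /B' mulr_sumr; apply: eq_big_nat => m /andP[_ lt_m].
  have -> : ((P + Q).+2 - m - 2 = P + Q - m)%N by lia.
  have -> : ((P + Q).+2 - m - 1 = (P + Q - m).+1)%N by lia.
  by rewrite subn1 addn1 /= [(-1) ^+ m.+1]exprS; field.
rewrite AE BE.
set S1 := Stilde _ _ _ _; set S2 := Stilde _ _ _ _ => E.
have -> : y^-1 * S1 - (-1) ^+ (P + Q).+2 * S2 =
  y^-1 * (S1 - (-1) ^+ (P + Q).+2 * y * S2) by field.
have -> : S1 - (-1) ^+ (P + Q).+2 * y * S2 =
  ti P.+1 y * (Li Q.+1 (x * y)^-1 + (-1) ^+ Q.+1 * Li Q.+1 (x * y)) -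
  (- (-1) ^+ Q.+1 * A' + - (-1) ^+ Q.+1 * x^-1 * B' - (-1) ^+ Q.+1 * C * ti (P + Q).+2 y).
  rewrite -E; ring.
by rewrite invfM; ring.
Qed.
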